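(* Every FR$^+$-algebra is a subdirect product of totally-ordered FR$^+$-algebras.
   Context: An MV-algebra is a structure $(A,\oplus,{}^*,0)$ with $(A,\oplus,0)$ a commutative monoid, $(x^* )^*=x$, $x\oplus 0^*=0^*$ and $(x^*\oplus y)^*\oplus y=(y^*\oplus x)^*\oplus x$; put $1=0^*$, $x\odot y=(x^*\oplus y^* )^*$, order $x\le y$ iff $x\odot y^*=0$ (a lattice order, $x\wedge y=x\odot(x^*\oplus y)$). A PMVf-algebra is an MV-algebra with an associative binary operation $\cdot$ satisfying $z\cdot(x\odot(x\wedge y)^* )=(z\cdot x)\odot(z\cdot(x\wedge y))^*$, $(x\odot(x\wedge y)^* )\cdot z=(x\cdot z)\odot((x\wedge y)\cdot z)^*$, and: $x\wedge y=0$ implies $(x\cdot z)\wedge y=(z\cdot x)\wedge y=0$. A Riesz MV-algebra is an MV-algebra with unary operations $x\mapsto\alpha x$ ($\alpha\in[0,1]$) with $\alpha(x\odot y^* )=(\alpha x)\odot(\alpha y)^*$, $\max(0,\alpha-\beta)x=(\alpha x)\odot(\beta x)^*$, $\alpha(\beta x)=(\alpha\beta)x$, $1x=x$. An fMV-algebra is a structure $(A,\oplus,\cdot,{}^*,\{\alpha\}_{\alpha\in[0,1]},0)$ which is a PMVf-algebra and a Riesz MV-algebra (sharing the MV-structure) with $\alpha(x\cdot y)=(\alpha x)\cdot y=x\cdot(\alpha y)$. An FR$^+$-algebra is an fMV-algebra that is unital ($\cdot$ has an identity element), commutative ($\cdot$ commutative) and semiprime ($x^n=x\cdot\ldots\cdot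 x=0$ for some $n\ge1$ implies $x=0$); equivalently, a member of the quasi-variety generated by the standard fMV-algebra $[0,1]$ (with $x\oplus y=\min(1,x+y)$, $x^*=1-x$, product and scalar multiplication the real product). Totally ordered means the order $\le$ is total. *)

(* Defs.v *)
From HB Require Import structures.
From mathcomp Require Import all_boot all_order all_algebra.
From mathcomp Require Import boolp reals.
From mathcomp Require Import interval_inference.

Set Implicit Arguments.
Unset Strict Implicit.
Unset Printing Implicit Defensive.

Import Order.TTheory GRing.Theory Num.Theory.

Declare Scope mv_scope.
Delimit Scope mv_scope with mv.

(* Carriers are bare types: no choice or decidable equality is assumed. *)
HB.mixin Record isMVAlgebra (A : Type) := {
  mvadd : A -> A -> A;
  mvneg : A -> A;
  mvzero : A;
  mvaddA : forall x y z, mvadd x (mvadd y z) = mvadd (mvadd x y) z;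
  mvaddC : forall x y, mvadd x y = mvadd y x;
  mvadd0 : forall x, mvadd x mvzero = x;
  mvnegK : forall x, mvneg (mvneg x) = x;
  mvadd1 : forall x, mvadd x (mvneg mvzero) = mvneg mvzero;
  mv_luk : forall x y,
    mvadd (mvneg (mvadd (mvneg x) y)) y = mvadd (mvneg (mvadd (mvneg y) x)) x
}.

#[short(type="mvAlgType")]
HB.structure Definition MVAlgebra := { A of isMVAlgebra A }.

Arguments mvzero {s}.

Section MVDerived.
Variable A : mvAlgType.
Implicit Types x y : A.

Definition mvone : A := mvneg mvzero.
Definition mvodot x y : A := mvneg (mvadd (mvneg x) (mvneg y)).
Definition mvmeet x y : A := mvodot x (mvadd (mvneg x) y).
Definition mvle x y : Prop := mvodot x (mvneg y) = mvzero.

End MVDerived.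

Arguments mvone {A}.

Notation "x ⊕ y" := (mvadd x y) (at level 50, left associativity) : mv_scope.
Notation "x ⊙ y" := (mvodot x y) (at level 40, left associativity) : mv_scope.
Notation "x ⊓ y" := (mvmeet x y) (at level 48, left associativity) : mv_scope.
Notation "x ^*" := (mvneg x) : mv_scope.
Notation "0" := mvzero : mv_scope.
Notation "1" := mvone : mv_scope.
Notation "x <= y" := (mvle x y) : mv_scope.

Definition totally_ordered (A : mvAlgType) : Prop :=
  forall x y : A, (x <= y)%mv \/ (y <= x)%mv.

HB.mixin Record isPMVf A of MVAlgebra A := {
  pmul : A -> A -> A;
  pmulA : forall x y z, pmul x (pmul y z) = pmul (pmul x y) z;
  pmulBr : forall x y z : A,
    (pmul z (x ⊙ (x ⊓ y)^*) = pmul z x ⊙ (pmul z (x ⊓ y))^*)%mv;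
  pmulBl : forall x y z : A,
    (pmul (x ⊙ (x ⊓ y)^*) z = pmul x z ⊙ (pmul (x ⊓ y) z)^*)%mv;
  pmulf : forall x y z : A, (x ⊓ y = 0)%mv ->
    (pmul x z ⊓ y = 0)%mv /\ (pmul z x ⊓ y = 0)%mv
}.

#[short(type="pmvfAlgType")]
HB.structure Definition PMVfAlgebra := { A of isPMVf A & MVAlgebra A }.

Notation "x ⋅ y" := (pmul x y) (at level 40, left associativity) : mv_scope.

HB.mixin Record isRieszMV (R : realType) A of MVAlgebra A := {
  mvscale : {i01 R} -> A -> A;
  mvscaleBr : forall (a : {i01 R}) (x y : A),
    (mvscale a (x ⊙ y^*) = mvscale a x ⊙ (mvscale a y)^*)%mv;
  mvscaleBl : forall (a b : {i01 R}) (x : A),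
    (mvscale (Num.max 0 (a%:num - b%:num))%R%:i01%R x
     = mvscale a x ⊙ (mvscale b x)^*)%mv;
  mvscaleA : forall (a b : {i01 R}) (x : A),
    mvscale a (mvscale b x) = mvscale (a%:num * b%:num)%R%:i01%R x;
  mvscale1 : forall x : A, mvscale 1%R%:i01%R x = x
}.

#[short(type="rieszMVAlgType")]
HB.structure Definition RieszMVAlgebra (R : realType) :=
  { A of isRieszMV R A & MVAlgebra A }.

Notation "a *: x" := (mvscale a x) : mv_scope.

HB.mixin Record PMVf_Riesz_isFMV (R : realType) A
    of PMVfAlgebra A & RieszMVAlgebra R A := {
  mvscaleAl : forall (a : {i01 R}) (x y : A),
    (a *: (x ⋅ y) = (a *: x) ⋅ y)%mv;
  mvscaleAr : forall (a : {i01 R}) (x y : A),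
    (a *: (x ⋅ y) = x ⋅ (a *: y))%mv
}.

#[short(type="fmvAlgType")]
HB.structure Definition FMVAlgebra (R : realType) :=
  { A of PMVf_Riesz_isFMV R A & PMVfAlgebra A & RieszMVAlgebra R A }.

Section FRplus.
Variables (R : realType) (A : fmvAlgType R).

Definition unital : Prop :=
  exists u : A, forall x : A, (u ⋅ x = x)%mv /\ (x ⋅ u = x)%mv.

Definition pcommutative : Prop := forall x y : A, (x ⋅ y = y ⋅ x)%mv.

(* The last argument of [iterop] is only its value at [n = 0]. *)
Definition ppow (x : A) (n : nat) : A := iterop n (@pmul A) x mvone.

Definition semiprime : Prop :=
  forall (x : A) (n : nat), 0 < n -> ppow x n = mvzero -> x = mvzero.

Definition FRplus : Prop := [/\ unital, pcommutative & semiprime].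

End FRplus.

Definition fmv_morphism (R : realType) (A B : fmvAlgType R) (f : A -> B) :
    Prop :=
  [/\ forall x y, f (x ⊕ y)%mv = (f x ⊕ f y)%mv,
      forall x, f (x^*)%mv = ((f x)^*)%mv,
      f 0%mv = 0%mv,
      forall x y, f (x ⋅ y)%mv = (f x ⋅ f y)%mv
    & forall (a : {i01 R}) x, f (a *: x)%mv = (a *: f x)%mv].

Definition fmv_prod (R : realType) (I : Type) (B : I -> fmvAlgType R) : Type :=
  forall i, B i.

Section DirectProduct.
Variables (R : realType) (I : Type) (B : I -> fmvAlgType R).
Implicit Types x y z : fmv_prod B.

Let padd x y : fmv_prod B := fun i => (x i ⊕ y i)%mv.
Let pneg x : fmv_prod B := fun i => ((x i)^*)%mv.
Let pzero : fmv_prod B := fun i => 0%mv.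
Let pprod x y : fmv_prod B := fun i => (x i ⋅ y i)%mv.
Let pscale (a : {i01 R}) x : fmv_prod B := fun i => (a *: x i)%mv.

Let paddA x y z : padd x (padd y z) = padd (padd x y) z.
Proof. by apply: functional_extensionality_dep => i; apply: mvaddA. Qed.

Let paddC x y : padd x y = padd y x.
Proof. by apply: functional_extensionality_dep => i; apply: mvaddC. Qed.

Let padd0 x : padd x pzero = x.
Proof. by apply: functional_extensionality_dep => i; apply: mvadd0. Qed.

Let pnegK x : pneg (pneg x) = x.
Proof. by apply: functional_extensionality_dep => i; apply: mvnegK. Qed.

Let padd1 x : padd x (pneg pzero) = pneg pzero.
Proof. by apply: functional_extensionality_dep => i; apply: mvadd1. Qed.

Let p_luk x y : padd (pneg (padd (pneg x) y)) y = padd (pneg (padd (pneg y) x)) x.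
Proof. by apply: functional_extensionality_dep => i; apply: mv_luk. Qed.

HB.instance Definition _ :=
  isMVAlgebra.Build (fmv_prod B) paddA paddC padd0 pnegK padd1 p_luk.

Let pprodA x y z : pprod x (pprod y z) = pprod (pprod x y) z.
Proof. by apply: functional_extensionality_dep => i; apply: pmulA. Qed.

Let pprodBr x y z :
  (pprod z (x ⊙ (x ⊓ y)^*) = pprod z x ⊙ (pprod z (x ⊓ y))^*)%mv.
Proof. by apply: functional_extensionality_dep => i; apply: pmulBr. Qed.

Let pprodBl x y z :
  (pprod (x ⊙ (x ⊓ y)^*) z = pprod x z ⊙ (pprod (x ⊓ y) z)^*)%mv.
Proof. by apply: functional_extensionality_dep => i; apply: pmulBl. Qed.

Let pprodf x y z : (x ⊓ y = 0)%mv ->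
  (pprod x z ⊓ y = 0)%mv /\ (pprod z x ⊓ y = 0)%mv.
Proof.
move=> xy0.
have xyi i : (x i ⊓ y i = 0)%mv by exact: (congr1 (fun f : fmv_prod B => f i) xy0).
by split; apply: functional_extensionality_dep => i;
  case: (pmulf _ _ (z i) (xyi i)).
Qed.

HB.instance Definition _ :=
  isPMVf.Build (fmv_prod B) pprodA pprodBr pprodBl pprodf.

Let pscaleBr a x y : (pscale a (x ⊙ y^*) = pscale a x ⊙ (pscale a y)^*)%mv.
Proof. by apply: functional_extensionality_dep => i; apply: mvscaleBr. Qed.

Let pscaleBl (a b : {i01 R}) x :
  (pscale (Num.max 0 (a%:num - b%:num))%R%:i01%R x
   = pscale a x ⊙ (pscale b x)^*)%mv.
Proof. by apply: functional_extensionality_dep => i; apply: mvscaleBl. Qed.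

Let pscaleA (a b : {i01 R}) x :
  pscale a (pscale b x) = pscale (a%:num * b%:num)%R%:i01%R x.
Proof. by apply: functional_extensionality_dep => i; apply: mvscaleA. Qed.

Let pscale1 x : pscale 1%R%:i01%R x = x.
Proof. by apply: functional_extensionality_dep => i; apply: mvscale1. Qed.

HB.instance Definition _ :=
  isRieszMV.Build R (fmv_prod B) pscaleBr pscaleBl pscaleA pscale1.

Let pscaleAl (a : {i01 R}) x y : (a *: (x ⋅ y) = (a *: x) ⋅ y)%mv.
Proof. by apply: functional_extensionality_dep => i; apply: mvscaleAl. Qed.

Let pscaleAr (a : {i01 R}) x y : (a *: (x ⋅ y) = x ⋅ (a *: y))%mv.
Proof. by apply: functional_extensionality_dep => i; apply: mvscaleAr. Qed.

HB.instance Definition _ :=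
  PMVf_Riesz_isFMV.Build R (fmv_prod B) pscaleAl pscaleAr.

End DirectProduct.

(* As usual in universal algebra, the subalgebra of the direct product is
   taken up to isomorphism, that is, as the image of an embedding. *)
Definition subdirect_product (R : realType) (A : fmvAlgType R) (I : Type)
    (B : I -> fmvAlgType R) : Prop :=
  exists f : A -> fmv_prod B,
    [/\ fmv_morphism f,
        injective f
      & forall i (y : B i), exists x : A, f x i = y].

(* Main.v *)
(* It is enough to separate every nonzero x from 0 by a totally ordered FR+
   quotient. By Zorn's lemma x lies in a maximal proper lattice filter F, and
   the complement P of F is a prime ideal. The identity of the product must be 1,
   so x.z <= x and P is stable under products; linearity of A/P follows from
   (x - y) /\ (y - x) = 0. The quotient is again semiprime because P is minimal:
   if x^n is in P, then x^n /\ s = 0 for some s in F, so (x /\ s)^n = 0, whence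
   x /\ s = 0 and x is in P. *)
Require Import Defs.
From HB Require Import structures.
From mathcomp Require Import all_boot all_order all_algebra.
From mathcomp Require Import boolp classical_sets reals.
From mathcomp Require Import interval_inference.

Set Implicit Arguments.
Unset Strict Implicit.
Unset Printing Implicit Defensive.

Import Order.TTheory GRing.Theory Num.Theory.

Local Open Scope classical_set_scope.
Local Open Scope mv_scope.

(** * Order and lattice arithmetic of MV-algebras *)

Section MVTheory.
Variable A : mvAlgType.
Implicit Types x y z w : A.

Lemma mvneg0 : 0^* = 1 :> A. Proof. by []. Qed.

Lemma mvneg1 : 1^* = 0 :> A. Proof. exact: mvnegK. Qed.

Lemma mvaddr1 x : x ⊕ 1 = 1. Proof. exact: mvadd1. Qed.

Lemma mvadd0l x : 0 ⊕ x = x. Proof. by rewrite mvaddC mvadd0. Qed.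

Lemma mvaddNl x : x^* ⊕ x = 1.
Proof. by have := mv_luk x 1; rewrite mvneg1 mvadd0l !mvaddr1 => <-. Qed.

Lemma mvaddNr x : x ⊕ x^* = 1. Proof. by rewrite mvaddC mvaddNl. Qed.

Lemma mvnegD x y : (x ⊕ y)^* = x^* ⊙ y^*.
Proof. by rewrite /mvodot !mvnegK. Qed.

Lemma mvnegM x y : (x ⊙ y)^* = x^* ⊕ y^*. Proof. exact: mvnegK. Qed.

Lemma mvodotC x y : x ⊙ y = y ⊙ x. Proof. by rewrite /mvodot mvaddC. Qed.

Lemma mvodotA x y z : x ⊙ (y ⊙ z) = x ⊙ y ⊙ z.
Proof. by rewrite /mvodot !mvnegK mvaddA. Qed.

Lemma mvodotN x : x ⊙ x^* = 0.
Proof. by rewrite /mvodot mvaddNr mvneg1. Qed.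

Lemma mvodot1 x : x ⊙ 1 = x.
Proof. by rewrite /mvodot mvneg1 mvadd0 mvnegK. Qed.

Lemma mvodot0 x : x ⊙ 0 = 0.
Proof. by rewrite /mvodot mvaddr1 mvneg1. Qed.

Lemma mvodot0l x : 0 ⊙ x = 0. Proof. by rewrite mvodotC mvodot0. Qed.

(** This is the Łukasiewicz axiom read at the negations of [x] and [y]. *)
Lemma mvmeetC x y : x ⊓ y = y ⊓ x.
Proof.
rewrite /mvmeet /mvodot (mvaddC x^* (_ ^*)) (mvaddC y^* (_ ^*)).
rewrite (mvaddC x^* y) (mvaddC y^* x).
by have := mv_luk y^* x^*; rewrite !mvnegK => ->.
Qed.

Lemma mvle_refl x : x <= x. Proof. exact: mvodotN. Qed.

Lemma mvle0x x : 0 <= x. Proof. exact: mvodot0l. Qed.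

Lemma mvlex1 x : x <= 1. Proof. by rewrite /mvle mvneg1 mvodot0. Qed.

(** Residuation: [x ⊙ y^*] is truncated subtraction, written [x - y] in these comments, and both
    sides say [x ⊙ y^* ⊙ z^* = 0]. Most inequalities about sums come from moving a summand
    across. *)
Lemma mvle_subLR x y z : x ⊙ y^* <= z <-> x <= y ⊕ z.
Proof. by rewrite /mvle mvnegD mvodotA. Qed.

Lemma mvle_addr x y : x <= x ⊕ y.
Proof. by apply/mvle_subLR; rewrite mvodotN; exact: mvle0x. Qed.

Lemma mvle_addl x y : y <= x ⊕ y. Proof. by rewrite mvaddC; exact: mvle_addr. Qed.

Lemma mvodot_lel x y : x ⊙ y <= x.
Proof. by rewrite -[y]mvnegK; apply/mvle_subLR; exact: mvle_addl. Qed.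

Lemma mvodot_ler x y : x ⊙ y <= y.
Proof. by rewrite mvodotC; exact: mvodot_lel. Qed.

Lemma mvleE x y : x <= y <-> x ⊓ y = x.
Proof.
split=> [xy|<-]; last first.
  by rewrite mvmeetC; exact: mvodot_lel.
have -> : x ⊓ y = x ⊙ (x ⊙ y^*)^* by rewrite mvnegM mvnegK.
by rewrite xy mvodot1.
Qed.

Lemma mvle_anti x y : x <= y -> y <= x -> x = y.
Proof. by move=> /mvleE xy /mvleE yx; rewrite -xy mvmeetC yx. Qed.

(** Since [x = y ⊓ x] has [y] as a factor for [⊙], the equation [y ⊙ z^* = 0] gives
    [x ⊙ z^* = 0]. *)
Lemma mvle_trans y x z : x <= y -> y <= z -> x <= z.
Proof.
move=> /mvleE <- yz; rewrite /mvle mvmeetC /mvmeet (mvodotC y) -mvodotA.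
by rewrite [y ⊙ _]yz mvodot0.
Qed.

Lemma mvlex0 x : x <= 0 -> x = 0.
Proof. by move=> /mvle_anti; apply; exact: mvle0x. Qed.

Lemma mvle_odot2r z x y : x <= y -> x ⊙ z <= y ⊙ z.
Proof.
move=> xy; rewrite -[z]mvnegK; apply/mvle_subLR.
by apply: mvle_trans xy _; apply/mvle_subLR; exact: mvle_refl.
Qed.

Lemma mvle_neg x y : x <= y -> y^* <= x^*.
Proof. by rewrite /mvle mvnegK mvodotC. Qed.

Lemma mvle_sub2l z x y : x <= y -> z ⊙ y^* <= z ⊙ x^*.
Proof. by move=> /mvle_neg; rewrite !(mvodotC z); exact: mvle_odot2r. Qed.

Lemma mvle_add2r z x y : x <= y -> x ⊕ z <= y ⊕ z.
Proof.
move=> /mvle_neg /(mvle_odot2r z^*) /mvle_neg.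
by rewrite !mvnegM !mvnegK.
Qed.

Lemma mvle_add x y z w : x <= y -> z <= w -> x ⊕ z <= y ⊕ w.
Proof.
move=> xy zw; apply: (mvle_trans (mvle_add2r z xy)).
by rewrite !(mvaddC y); exact: mvle_add2r.
Qed.

Lemma mvmeet_lel x y : x ⊓ y <= x. Proof. exact: mvodot_lel. Qed.

Lemma mvmeet_ler x y : x ⊓ y <= y. Proof. by rewrite mvmeetC; exact: mvmeet_lel. Qed.

Lemma mvmeetE x y : x ⊓ y = x ⊙ (x ⊙ y^*)^*.
Proof. by rewrite mvnegM mvnegK. Qed.

Lemma mvsub_subK x y : y <= x -> x ⊙ (x ⊙ y^*)^* = y.
Proof. by move=> /mvleE; rewrite mvmeetC mvmeetE. Qed.

Lemma mvsub_meet x y : x ⊙ (x ⊓ y)^* = x ⊙ y^*.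
Proof. by rewrite mvmeetE mvsub_subK //; exact: mvodot_lel. Qed.

(** Here [z = x - (x - z)] and [x ⊓ y = x - (x - y)]; subtracting from [x] is antitone, so doing it
    twice preserves [z <= y]. *)
Lemma mvle_meet x y z : z <= x -> z <= y -> z <= x ⊓ y.
Proof.
move=> /mvleE zx zy; rewrite -zx mvmeetC !mvmeetE.
by apply: mvle_sub2l; apply: mvle_sub2l.
Qed.

Lemma mvmeetxx x : x ⊓ x = x.
Proof. by apply/mvleE; exact: mvle_refl. Qed.

Lemma mvmeetx0 x : x ⊓ 0 = 0.
Proof. by apply: mvlex0; exact: mvmeet_ler. Qed.

Lemma mvle_meet2 x y z w : x <= y -> z <= w -> x ⊓ z <= y ⊓ w.
Proof.
move=> xy zw; apply: mvle_meet.
- exact: mvle_trans (mvmeet_lel _ _) xy.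
- exact: mvle_trans (mvmeet_ler _ _) zw.
Qed.

Lemma mvmeetA x y z : x ⊓ (y ⊓ z) = x ⊓ y ⊓ z.
Proof.
apply: mvle_anti;
  [apply: mvle_meet; [apply: mvle_meet|]|apply: mvle_meet; [|apply: mvle_meet]].
- exact: mvmeet_lel.
- exact: mvle_trans (mvmeet_ler _ _) (mvmeet_lel _ _).
- exact: mvle_trans (mvmeet_ler _ _) (mvmeet_ler _ _).
- exact: mvle_trans (mvmeet_lel _ _) (mvmeet_lel _ _).
- exact: mvle_trans (mvmeet_lel _ _) (mvmeet_ler _ _).
- exact: mvmeet_ler.
Qed.

Lemma mvle_meetDr w x y z : w <= x ⊕ y -> w <= x ⊕ z -> w <= x ⊕ (y ⊓ z).
Proof.
by move=> /mvle_subLR wy /mvle_subLR wz; apply/mvle_subLR; exact: mvle_meet.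
Qed.

(** Distributing [⊕] over [⊓] on the right leaves four sums to compare: [y ⊕ x] and three with a
    summand [z]. Consequently the elements disjoint from a given one are closed under [⊕]. *)
Lemma mvmeetD_le x y z : (x ⊕ y) ⊓ z <= (x ⊓ z) ⊕ (y ⊓ z).
Proof.
apply: mvle_meetDr; rewrite (mvaddC (x ⊓ z)).
- apply: mvle_meetDr.
  + by rewrite mvaddC; exact: mvmeet_lel.
  + exact: mvle_trans (mvmeet_ler _ _) (mvle_addl _ _).
- apply: mvle_meetDr.
  + exact: mvle_trans (mvmeet_ler _ _) (mvle_addr _ _).
  + exact: mvle_trans (mvmeet_ler _ _) (mvle_addr _ _).
Qed.

(** Prelinearity. With [q] the residual of [w] by [x], so that [x ⊙ q = x ⊓ w], the meet becomes a
    [⊙]-product containing the factors [x^*] and [y ⊓ q^*]. The latter is below [q^* = x - w], hence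
    below [x], and [x ⊙ x^* = 0]. *)
Lemma mvsub_meet0 x y : (x ⊙ y^*) ⊓ (y ⊙ x^*) = 0.
Proof.
set w := y ⊙ x^*; set q := x^* ⊕ w.
have -> : (x ⊙ y^*) ⊓ w = x ⊙ (y^* ⊓ q).
  by rewrite /mvmeet mvnegM !mvnegK mvodotA /q mvaddA (mvaddC y).
have xq : x ⊙ q = x^* ⊙ (w^* ⊕ x) ⊙ y.
  by rewrite -/(mvmeet x w) mvmeetC /mvmeet {1}/w -!mvodotA mvodotC -mvodotA.
have yq : y ⊙ (q^* ⊕ y^*) <= x.
  rewrite mvaddC; apply: mvle_trans (mvmeet_ler y q^*) _.
  by rewrite mvnegD mvnegK; exact: mvodot_lel.
rewrite mvmeetC /mvmeet mvodotA xq -mvodotA; apply: mvlex0.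
apply: mvle_trans (mvle_odot2r _ (mvodot_lel _ _)) _.
by rewrite mvodotC; have := mvle_odot2r x^* yq; rewrite mvodotN.
Qed.

Lemma mvsub_trans x y z :
  x ⊙ z^* <= (x ⊙ y^*) ⊕ (y ⊙ z^*).
Proof.
apply/mvle_subLR; rewrite mvaddC -mvaddA; apply: mvle_trans (_ : _ <= (x ⊙ y^*) ⊕ y) _.
  by rewrite mvaddC; apply/mvle_subLR; exact: mvle_refl.
apply: mvle_add (mvle_refl _) _.
by rewrite mvaddC; apply/mvle_subLR; exact: mvle_refl.
Qed.

End MVTheory.

(** * Monotonicity of the product and its behaviour under subtraction *)

Section PMVfTheory.
Variable A : pmvfAlgType.
Implicit Types x y z : A.

Lemma pmulBr_le x y z : y <= x -> z ⋅ (x ⊙ y^*) = (z ⋅ x) ⊙ (z ⋅ y)^*.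
Proof. by move=> /mvleE xy; rewrite -{1 2}xy mvmeetC pmulBr mvmeetC xy. Qed.

Lemma pmulBl_le x y z : y <= x -> (x ⊙ y^*) ⋅ z = (x ⋅ z) ⊙ (y ⋅ z)^*.
Proof. by move=> /mvleE xy; rewrite -{1 2}xy mvmeetC pmulBl mvmeetC xy. Qed.

(* Additivity only gives [z(y - x) = zy - zx] with truncated subtraction, which
   does not bound [zx]; applied to [x = y - (y - x)] instead, it does. *)
Lemma pmul_ler z x y : x <= y -> z ⋅ x <= z ⋅ y.
Proof.
move=> xy; rewrite -{1}(mvsub_subK xy) pmulBr_le; last exact: mvodot_lel.
exact: mvodot_lel.
Qed.

Lemma pmul_lel z x y : x <= y -> x ⋅ z <= y ⋅ z.
Proof.
move=> xy; rewrite -{1}(mvsub_subK xy) pmulBl_le; last exact: mvodot_lel.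
exact: mvodot_lel.
Qed.

(** Replacing [y] by [x ⊓ y] leaves [x - y] unchanged and makes the axiom applicable; monotonicity
    then compares [z ⋅ (x ⊓ y)] with [z ⋅ y]. This makes congruence modulo an ideal compatible with
    products. *)
Lemma pmulBr_sub x y z : (z ⋅ x) ⊙ (z ⋅ y)^* <= z ⋅ (x ⊙ y^*).
Proof.
rewrite -[x ⊙ _]mvsub_meet pmulBr; apply: mvle_sub2l.
by apply: pmul_ler; exact: mvmeet_ler.
Qed.

Lemma pmulBl_sub x y z : (x ⋅ z) ⊙ (y ⋅ z)^* <= (x ⊙ y^*) ⋅ z.
Proof.
rewrite -[x ⊙ _]mvsub_meet pmulBl; apply: mvle_sub2l.
by apply: pmul_lel; exact: mvmeet_ler.
Qed.

(** Subtractivity gives [1 ⋅ u^* = 1 ⋅ 1 - 1 ⋅ u = 1 ⋅ 1 - 1 = 0], while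
    [u^* = u ⋅ u^* <= 1 ⋅ u^*]. *)
Lemma pmul_unit1 (u : A) : (forall x, u ⋅ x = x /\ x ⋅ u = x) -> u = 1.
Proof.
move=> hu.
have u11 : (1 : A) <= 1 ⋅ 1.
  by rewrite -{1}[1](proj1 (hu _)); apply: pmul_lel; exact: mvlex1.
have u10 : 1 ⋅ u^* = 0 :> A.
  rewrite -[u^*]mvodot1 mvodotC pmulBr_le; last exact: mvlex1.
  by rewrite (proj2 (hu _)); apply: mvlex0; rewrite mvneg1; exact: mvodot_ler.
have u0 : u^* = 0.
  by apply: mvlex0; rewrite -u10 -{1}[u^*](proj1 (hu _)); apply: pmul_lel; exact: mvlex1.
by rewrite -[u]mvnegK u0.
Qed.

End PMVfTheory.

(** * Scalars are contractions *)

Section ScaleTheory.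
Variables (R : realType) (A : rieszMVAlgType R).
Implicit Types (a : {i01 R}) (x y : A).

(** The difference of [a *: x] and [1 *: x] is the multiple of [x] by [max(0, a - 1) = 0].
    Down-closed sets are thus stable under scalars, which is why [fmv_ideal] has no clause for
    them. *)
Lemma mvscale_le a x : a *: x <= x.
Proof.
have scale0 : (0%R%:i01%R : {i01 R}) *: x = 0.
  rewrite -(mvodotN (1%R%:i01%R *: x)) -mvscaleBl; congr (_ *: _).
  by apply/val_inj; rewrite /= subrr maxxx.
rewrite /mvle -{2}[x](@mvscale1 R) -mvscaleBl -scale0; congr (_ *: _).
by apply/val_inj => /=; apply/max_idPl; rewrite subr_le0.
Qed.

End ScaleTheory.

(** * Ideals and quotients of fMV-algebras *)

Record fmv_ideal (R : realType) (A : fmvAlgType R) (I : set A) : Prop := {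
  ideal0 : I 0;
  ideal_le : forall x y, x <= y -> I y -> I x;
  idealD : forall x y, I x -> I y -> I (x ⊕ y);
  idealMl : forall x z, I x -> I (x ⋅ z);
  idealMr : forall x z, I x -> I (z ⋅ x)
}.

Section Quotient.
Variables (R : realType) (A : fmvAlgType R) (I : set A) (hI : fmv_ideal I).
Implicit Types (a b : {i01 R}) (x y z w : A).

Definition eqmod x y : Prop := I (x ⊙ y^*) /\ I (y ⊙ x^*).

Lemma eqmod_refl x : eqmod x x.
Proof. by split; rewrite mvodotN; exact: ideal0 hI. Qed.

Lemma eqmod_sym x y : eqmod x y -> eqmod y x.
Proof. by case. Qed.

Lemma eqmod_trans y x z : eqmod x y -> eqmod y z -> eqmod x z.
Proof.
move=> [xy yx] [yz zy]; split.
- exact: (ideal_le hI (mvsub_trans _ y _) (idealD hI xy yz)).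
- exact: (ideal_le hI (mvsub_trans _ y _) (idealD hI zy yx)).
Qed.

Lemma eqmodN x y : eqmod x y -> eqmod x^* y^*.
Proof. by case=> xy yx; split; rewrite mvnegK mvodotC. Qed.

Lemma eqmodDr x y z : eqmod x y -> eqmod (x ⊕ z) (y ⊕ z).
Proof.
suff H u v : I (u ⊙ v^*) -> I ((u ⊕ z) ⊙ (v ⊕ z)^*) by case=> *; split; exact: H.
apply: (ideal_le hI); apply/mvle_subLR.
rewrite -mvaddA (mvaddC z) mvaddA; apply: mvle_add2r.
by apply/mvle_subLR; exact: mvle_refl.
Qed.

Lemma eqmodD x y z w : eqmod x y -> eqmod z w -> eqmod (x ⊕ z) (y ⊕ w).
Proof.
move=> xy zw; apply: eqmod_trans (eqmodDr z xy) _.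
by rewrite !(mvaddC y); exact: eqmodDr.
Qed.

Lemma eqmodM x y z w : eqmod x y -> eqmod z w -> eqmod (x ⋅ z) (y ⋅ w).
Proof.
move=> [xy yx] [zw wz]; apply: (@eqmod_trans (y ⋅ z)); split.
- exact: (ideal_le hI (pmulBl_sub _ _ _) (idealMl hI _ xy)).
- exact: (ideal_le hI (pmulBl_sub _ _ _) (idealMl hI _ yx)).
- exact: (ideal_le hI (pmulBr_sub _ _ _) (idealMr hI _ zw)).
- exact: (ideal_le hI (pmulBr_sub _ _ _) (idealMr hI _ wz)).
Qed.

Lemma eqmodZ a x y : eqmod x y -> eqmod (a *: x) (a *: y).
Proof.
by case=> xy yx; split; rewrite -mvscaleBr; apply: (ideal_le hI (mvscale_le _ _)).
Qed.

Lemma eqmod0 x : eqmod x 0 <-> I x.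
Proof.
split=> [[]|Ix]; first by rewrite mvneg0 mvodot1.
by split; rewrite ?mvneg0 ?mvodot1 // mvodot0l; exact: ideal0 hI.
Qed.

(** In the quotient, the hypothesis of [pmulf] only says that [x ⊓ y] lies in [I]. The axiom is
    therefore applied in [A] to the truly disjoint elements [x - y] and [y - x]. *)
Lemma ideal_meetM x y z :
  I (x ⊓ y) -> I ((x ⋅ z) ⊓ y) /\ I ((z ⋅ x) ⊓ y).
Proof.
set c := x ⊓ y => Ic.
have cx : c <= x := mvmeet_lel x y.
(* Cut [p], a multiple of [x], by [q], the same multiple of [c]: the remainder
   is a multiple of [x - c = x - y], hence disjoint from [y - x]. *)
have key p q : I q -> p <= q ⊕ p ⊙ q^* -> (p ⊙ q^*) ⊓ (y ⊙ x^*) = 0 -> I (p ⊓ y).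
  (* The bound is [p ⊓ y <= q ⊕ ((p - q) ⊓ y) <= q ⊕ c], the second step because [y <= c ⊕ (y - x)]
     and [y - x] is disjoint from [p - q]. *)
  move=> Iq pq pq0; apply: (ideal_le hI _ (idealD hI Iq Ic)).
  apply: mvle_trans (mvle_meet2 pq (mvle_refl _)) _.
  apply: mvle_trans (mvmeetD_le _ _ _) _.
  apply: mvle_add; first exact: mvmeet_lel.
  have yc : y <= c ⊕ y ⊙ x^*.
    by apply/mvle_subLR; rewrite /c mvmeetC mvsub_meet; exact: mvle_refl.
  rewrite mvmeetC; apply: mvle_trans (mvle_meet2 yc (mvle_refl _)) _.
  apply: mvle_trans (mvmeetD_le _ _ _) _.
  by rewrite (mvmeetC (y ⊙ _)) pq0 mvadd0; exact: mvmeet_lel.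
have xc : x ⊙ c^* = x ⊙ y^* := mvsub_meet x y.
split.
- apply: (key _ (c ⋅ z)).
  + exact: idealMl.
  + by apply/mvle_subLR; exact: mvle_refl.
  + by rewrite -pmulBl_le // xc; case: (pmulf _ _ z (mvsub_meet0 x y)).
- apply: (key _ (z ⋅ c)).
  + exact: idealMr.
  + by apply/mvle_subLR; exact: mvle_refl.
  + by rewrite -pmulBr_le // xc; case: (pmulf _ _ z (mvsub_meet0 x y)).
Qed.

(** Classes are kept as sets, so that bare carriers suffice and equality of classes is extensional.
    The ideal proof is an argument of the type so that the algebra instances can depend on it. *)
Definition quot of fmv_ideal I : Type := {X : set A | exists x, X = eqmod x}.

Local Notation Q := (quot hI).

Definition qpi x : Q := exist _ (eqmod x) (ex_intro _ x erefl).

Definition qrepr (q : Q) : A := projT1 (cid (proj2_sig q)).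

Lemma qpiP x y : qpi x = qpi y <-> eqmod x y.
Proof.
split=> [/(congr1 (@proj1_sig _ _)) /= e|xy].
  by rewrite e; exact: eqmod_refl.
apply: eq_exist; apply/funext => z; apply/propext; split.
  exact/eqmod_trans/eqmod_sym.
exact: eqmod_trans.
Qed.

Lemma qreprK : cancel qrepr qpi.
Proof.
move=> q; rewrite /qpi /qrepr; case: cid => x /=; case: q => X hX /= eX.
exact: eq_exist.
Qed.

Lemma qpi_surj (q : Q) : exists x, qpi x = q.
Proof. by exists (qrepr q); exact: qreprK. Qed.

Let qadd (p q : Q) : Q := qpi (qrepr p ⊕ qrepr q).
Let qneg (p : Q) : Q := qpi (qrepr p)^*.
Let qmul (p q : Q) : Q := qpi (qrepr p ⋅ qrepr q).
Let qscale a (p : Q) : Q := qpi (a *: qrepr p).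

Let qrepr_pi x : eqmod (qrepr (qpi x)) x.
Proof. by apply/qpiP; exact: qreprK. Qed.

Let qaddE x y : qadd (qpi x) (qpi y) = qpi (x ⊕ y).
Proof. by apply/qpiP; exact: eqmodD. Qed.

Let qnegE x : qneg (qpi x) = qpi x^*.
Proof. by apply/qpiP; exact: eqmodN. Qed.

Let qmulE x y : qmul (qpi x) (qpi y) = qpi (x ⋅ y).
Proof. by apply/qpiP; exact: eqmodM. Qed.

Let qscaleE a x : qscale a (qpi x) = qpi (a *: x).
Proof. by apply/qpiP; exact: eqmodZ. Qed.

Let qaddA p q r : qadd p (qadd q r) = qadd (qadd p q) r.
Proof.
case: (qpi_surj p) (qpi_surj q) (qpi_surj r) => x <- [y <-] [z <-].
by rewrite !qaddE mvaddA.
Qed.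

Let qaddC p q : qadd p q = qadd q p.
Proof. by rewrite /qadd mvaddC. Qed.

Let qadd0 p : qadd p (qpi 0) = p.
Proof. by case: (qpi_surj p) => x <-; rewrite qaddE mvadd0. Qed.

Let qnegK p : qneg (qneg p) = p.
Proof. by case: (qpi_surj p) => x <-; rewrite !qnegE mvnegK. Qed.

Let qadd1 p : qadd p (qneg (qpi 0)) = qneg (qpi 0).
Proof. by case: (qpi_surj p) => x <-; rewrite !qnegE qaddE mvadd1. Qed.

Let q_luk p q : qadd (qneg (qadd (qneg p) q)) q = qadd (qneg (qadd (qneg q) p)) p.
Proof.
case: (qpi_surj p) (qpi_surj q) => x <- [y <-].
by rewrite !(qnegE, qaddE) mv_luk.
Qed.

HB.instance Definition _ :=
  isMVAlgebra.Build Q qaddA qaddC qadd0 qnegK qadd1 q_luk.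

Lemma qpiD x y : qpi (x ⊕ y) = qpi x ⊕ qpi y :> Q.
Proof. exact/esym/qaddE. Qed.

Lemma qpiN x : qpi x^* = (qpi x)^* :> Q.
Proof. exact/esym/qnegE. Qed.

Lemma qpi0 : qpi 0 = 0 :> Q.
Proof. by []. Qed.

Lemma qpi_odot x y : qpi (x ⊙ y) = qpi x ⊙ qpi y :> Q.
Proof. by rewrite /mvodot !(qpiN, qpiD). Qed.

Lemma qpi_meet x y : qpi (x ⊓ y) = qpi x ⊓ qpi y :> Q.
Proof. by rewrite /mvmeet qpi_odot qpiD qpiN. Qed.

Lemma qpi_eq0 x : qpi x = 0 :> Q <-> I x.
Proof. by rewrite -qpi0 qpiP eqmod0. Qed.

Let qmulA p q r : qmul p (qmul q r) = qmul (qmul p q) r.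
Proof.
case: (qpi_surj p) (qpi_surj q) (qpi_surj r) => x <- [y <-] [z <-].
by rewrite !qmulE pmulA.
Qed.

Let qmulBr p q r : qmul r (p ⊙ (p ⊓ q)^*) = qmul r p ⊙ (qmul r (p ⊓ q))^*.
Proof.
case: (qpi_surj p) (qpi_surj q) (qpi_surj r) => x <- [y <-] [z <-].
by rewrite -qpi_meet -qpiN -qpi_odot !qmulE pmulBr -qpiN -qpi_odot.
Qed.

Let qmulBl p q r : qmul (p ⊙ (p ⊓ q)^*) r = qmul p r ⊙ (qmul (p ⊓ q) r)^*.
Proof.
case: (qpi_surj p) (qpi_surj q) (qpi_surj r) => x <- [y <-] [z <-].
by rewrite -qpi_meet -qpiN -qpi_odot !qmulE pmulBl -qpiN -qpi_odot.
Qed.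

Let qmulf p q r : p ⊓ q = 0 -> qmul p r ⊓ q = 0 /\ qmul r p ⊓ q = 0.
Proof.
case: (qpi_surj p) (qpi_surj q) (qpi_surj r) => x <- [y <-] [z <-].
by rewrite !qmulE -!qpi_meet !qpi_eq0; exact: ideal_meetM.
Qed.

HB.instance Definition _ := isPMVf.Build Q qmulA qmulBr qmulBl qmulf.

Lemma qpiM x y : qpi (x ⋅ y) = qpi x ⋅ qpi y :> Q.
Proof. exact/esym/qmulE. Qed.

Let qscaleBr a p q : qscale a (p ⊙ q^*) = qscale a p ⊙ (qscale a q)^*.
Proof.
case: (qpi_surj p) (qpi_surj q) => x <- [y <-].
by rewrite -qpiN -qpi_odot !qscaleE mvscaleBr qpi_odot qpiN.
Qed.

Let qscaleBl a b p :
  qscale (Num.max 0 (a%:num - b%:num))%R%:i01%R p = qscale a p ⊙ (qscale b p)^*.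
Proof.
case: (qpi_surj p) => x <-.
by rewrite !qscaleE mvscaleBl qpi_odot qpiN.
Qed.

Let qscaleA a b p : qscale a (qscale b p) = qscale (a%:num * b%:num)%R%:i01%R p.
Proof. by case: (qpi_surj p) => x <-; rewrite !qscaleE mvscaleA. Qed.

Let qscale1 p : qscale 1%R%:i01%R p = p.
Proof. by case: (qpi_surj p) => x <-; rewrite qscaleE mvscale1. Qed.

HB.instance Definition _ := isRieszMV.Build R Q qscaleBr qscaleBl qscaleA qscale1.

Lemma qpiZ a x : qpi (a *: x) = a *: qpi x :> Q.
Proof. exact/esym/qscaleE. Qed.

Let qscaleAl a (p q : Q) : a *: (p ⋅ q) = (a *: p) ⋅ q.
Proof.
case: (qpi_surj p) (qpi_surj q) => x <- [y <-].
by rewrite -qpiM -!qpiZ mvscaleAl qpiM.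
Qed.

Let qscaleAr a (p q : Q) : a *: (p ⋅ q) = p ⋅ (a *: q).
Proof.
case: (qpi_surj p) (qpi_surj q) => x <- [y <-].
by rewrite -qpiM -!qpiZ mvscaleAr qpiM.
Qed.

HB.instance Definition _ := PMVf_Riesz_isFMV.Build R Q qscaleAl qscaleAr.

Lemma qpi_ppow x n : qpi (ppow x n) = ppow (qpi x) n :> Q.
Proof.
(* At [n = 0] both powers are the default value [1]. *)
case: n => [|n]; first by rewrite /ppow /= -mvneg0 qpiN.
by rewrite /ppow !iteropS; elim: n => //= n <-; exact: qpiM.
Qed.

Lemma quot_FRplus : unital A -> pcommutative A ->
  (forall x n, (0 < n)%N -> I (ppow x n) -> I x) -> FRplus Q.
Proof.
move=> [u hu] mulC rad; split.
- exists (qpi u) => q; case: (qpi_surj q) => x <-.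
  by rewrite -!qpiM; case: (hu x) => -> ->.
- by move=> p q; case: (qpi_surj p) (qpi_surj q) => x <- [y <-]; rewrite -!qpiM mulC.
- move=> q n n0; case: (qpi_surj q) => x <-.
  by rewrite -qpi_ppow => /qpi_eq0 xn; apply/qpi_eq0; exact: rad xn.
Qed.

Lemma quot_total : (forall x y, I (x ⊓ y) -> I x \/ I y) -> totally_ordered Q.
Proof.
move=> prime p q; case: (qpi_surj p) (qpi_surj q) => x <- [y <-].
have : I ((x ⊙ y^*) ⊓ (y ⊙ x^*)) by rewrite mvsub_meet0; exact: ideal0.
by rewrite /mvle -!qpiN -!qpi_odot => /prime[] H; [left|right]; apply/qpi_eq0.
Qed.

End Quotient.

(** * Maximal lattice filters *)

(* The members of a maximal proper filter [F] are the elements meeting all of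
   [F]; hence its complement is the set of elements disjoint from a member of
   [F], a minimal prime ideal. *)
Lemma maximal_meet_filter (A : mvAlgType) (x : A) : x <> 0 ->
  exists F : set A, [/\ F x, ~ F 0, forall y z, F y -> F z -> F (y ⊓ z)
    & forall a, ~ F a -> exists2 s, F s & a ⊓ s = 0].
Proof.
move=> x0.
(* [x] is adjoined inside [P] so that the empty chain satisfies [P]. *)
pose P (S : set A) := ~ (x |` S) 0 /\
  forall y z, (x |` S) y -> (x |` S) z -> (x |` S) (y ⊓ z).
have [C CP Ctot|M [PM Mmax]] := @Zorn_bigcup A P.
  split=> [[/esym //|[S CS S0]]|]; first by have [+ _] := CP _ CS; apply; right.
  move=> y z [->|[S CS Sy]] [->|[T CT Tz]].
  - by left; rewrite mvmeetxx.
  - have [_ /(_ x z) []] := CP _ CT; [by left|by right|by left|].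
    by right; exists T.
  - have [_ /(_ y x) []] := CP _ CS; [by right|by left|by left|].
    by right; exists S.
  (* Of the two members of the chain containing [y] and [z], the larger contains both. *)
  - wlog [U [CU SU TU]] : / exists U, [/\ C U, U y & U z].
      apply; case: (Ctot _ _ CS CT) => sub.
        by exists T; split=> //; exact: sub.
      by exists S; split=> //; exact: sub.
    have [_ /(_ y z) []] := CP _ CU; [by right|by right|by left|].
    by right; exists U.
have [F0 FI] := PM.
exists (x |` M); split=> //; first by left.
move=> a aF; apply: contrapT => noS.
pose N := [set z | exists2 s, (x |` M) s & a ⊓ s <= z].
have Fle s : (x |` M) s -> N s by exists s => //; exact: mvmeet_ler.
have Nx : x |` N = N by apply/seteqP; split=> [z [->|]|z Nz] //; [apply: Fle; left|right].
apply: (Mmax N).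
  rewrite properEneq; split; last by move=> z Mz; apply: Fle; right.
  by apply/eqP => MN; apply: aF; right; rewrite MN; exists x; [left|exact: mvmeet_lel].
rewrite /P Nx; split=> [[s Fs /mvlex0 as0]|y z [s Fs sy] [t Ft tz]].
  by apply: noS; exists s.
exists (s ⊓ t); first exact: FI.
apply: mvle_trans (mvle_meet2 sy tz); apply: mvle_meet; apply: mvle_meet2 (mvle_refl _) _.
  exact: mvmeet_lel.
exact: mvmeet_ler.
Qed.

(** * Prime ideals with semiprime quotient *)

Section PrimeIdeals.
Variables (R : realType) (A : fmvAlgType R).
Implicit Types x y : A.

Lemma pmul_lex x z : unital A -> x ⋅ z <= x /\ z ⋅ x <= x.
Proof.
case=> u hu; have u1 := pmul_unit1 hu; have [e1 e2] := hu x.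
by split; [rewrite -{2}e2|rewrite -{2}e1]; [apply: pmul_ler|apply: pmul_lel];
  rewrite u1; exact: mvlex1.
Qed.

Lemma ppow_le_base x n : unital A -> (0 < n)%N -> ppow x n <= x.
Proof.
case: n => [|[|n]] // hu _; first exact: mvle_refl.
by rewrite /ppow iteropS /=; case: (pmul_lex x (iter n (pmul x) x) hu).
Qed.

Lemma ppow_mono x y n : x <= y -> ppow x n <= ppow y n.
Proof.
move=> xy; case: n => [|n]; first exact: mvle_refl.
rewrite /ppow !iteropS; elim: n => //= n IHn.
exact: mvle_trans (pmul_lel _ xy) (pmul_ler _ IHn).
Qed.

(** The [n]-th power of [x ⊓ y] is below that of [x], and also below [x ⊓ y <= y] because [n] is
    positive; so it is [0], and semiprimeness applies. *)
Lemma ppow_meet0 x y n : FRplus A -> (0 < n)%N -> ppow x n ⊓ y = 0 -> x ⊓ y = 0.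
Proof.
move=> [hu _ hs] n0 xny; apply: (hs _ _ n0); apply: mvlex0; rewrite -xny.
apply: mvle_meet; first by apply: ppow_mono; exact: mvmeet_lel.
exact: mvle_trans (ppow_le_base _ hu n0) (mvmeet_ler _ _).
Qed.

(** The clauses provide in turn the quotient algebra, its linearity and its semiprimeness; the last
    is the only trace kept of minimality. *)
Definition frplus_prime (I : set A) : Prop :=
  [/\ fmv_ideal I, forall x y, I (x ⊓ y) -> I x \/ I y
    & forall x n, (0 < n)%N -> I (ppow x n) -> I x].

Lemma frplus_prime_avoiding x : FRplus A -> x <> 0 ->
  exists2 I, frplus_prime I & ~ I x.
Proof.
move=> hA x0; have [F [Fx F0 FI Fmax]] := maximal_meet_filter x0.
have Fdisj y s : F s -> y ⊓ s = 0 -> ~ F y by move=> Fs ys /FI/(_ Fs); rewrite ys.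
have Fup y z : y <= z -> ~ F z -> ~ F y.
  move=> yz /Fmax[s Fs zs]; apply: (Fdisj _ s) => //; apply: mvlex0; rewrite -zs.
  exact: mvle_meet2 yz (mvle_refl _).
have [hu _ _] := hA.
exists (~` F); last by apply.
split.
- split=> //.
  + move=> y z /Fmax[s Fs ys] /Fmax[t Ft zt].
    (* [s ⊓ t] is disjoint from both [y] and [z], hence from [y ⊕ z]. *)
    apply: (Fdisj _ (s ⊓ t)); first exact: FI.
    apply: mvlex0; apply: mvle_trans (mvmeetD_le _ _ _) _.
    rewrite mvmeetA ys [s ⊓ t]mvmeetC mvmeetA zt.
    by rewrite ![0 ⊓ _]mvmeetC !mvmeetx0 mvadd0; exact: mvle_refl.
  + by move=> y z; apply: Fup; case: (pmul_lex y z hu).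
  + by move=> y z; apply: Fup; case: (pmul_lex y z hu).
- move=> y z yz; case: (pselect (F y)) => Fy; [right => Fz|by left].
  exact: yz (FI _ _ Fy Fz).
- move=> y n n0 /Fmax[s Fs ys]; apply: (Fdisj _ s) => //.
  exact: ppow_meet0 ys.
Qed.

End PrimeIdeals.

(** * The subdirect embedding *)

Theorem theorem3p21 (R : realType) (A : fmvAlgType R) (hA : FRplus A) :
  exists (I : Type) (B : I -> fmvAlgType R),
    (forall i : I, FRplus (B i) /\ totally_ordered (B i)) /\
    subdirect_product A B.
Proof.
have [hu hc _] := hA.
pose idl (i : {I : set A | frplus_prime I}) : fmv_ideal (proj1_sig i) :=
  let: And3 h _ _ := proj2_sig i in h.
(* Indexing by all such ideals avoids choosing one for each nonzero element. *)
exists {I : set A | frplus_prime I}, (fun i => quot (idl i)); split.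
  move=> i; have [_ prime rad] := proj2_sig i.
  by split; [exact: quot_FRplus|exact: quot_total].
exists (fun x i => qpi (idl i) x); split.
- split; [move=> x y|move=> x| |move=> x y|move=> a x];
    apply: functional_extensionality_dep => i.
  + exact: qpiD.
  + exact: qpiN.
  + exact: qpi0.
  + exact: qpiM.
  + exact: qpiZ.
- have sep x : (forall i, qpi (idl i) x = 0) -> x = 0.
    move=> h; apply: contrapT => /(frplus_prime_avoiding hA)[I hI]; apply.
    by have /qpi_eq0 := h (exist _ I hI).
  (* Both differences [x - y] and [y - x] vanish in every quotient, hence in [A]. *)
  move=> x y xy; apply: mvle_anti; apply: sep => i;
    rewrite qpi_odot qpiN (congr1 (fun f => f i) xy : qpi _ x = qpi _ y);
    exact: mvodotN.
- by move=> i q; exact: qpi_surj.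
Qed.
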